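(* Let $A$ be a set of positive integers with $\gcd(A) = 1$. If $A$ has asymptotic density $d(A) = \alpha > 0$, then $\log p_A(n) \sim c_0\sqrt{\alpha n}$ as $n\to\infty$.
   Context: For a set $A$ of positive integers, $A(x)$ denotes the number of elements of $A$ not exceeding $x$. If the limit $d(A) = \lim_{x\to\infty} A(x)/x$ exists, it is called the asymptotic density of $A$. The greatest common divisor of all the elements of $A$ is denoted $\gcd(A)$. The partition function $p_A(n)$ counts the partitions of $n$ with parts in $A$, that is, representations of $n$ as a sum of not necessarily distinct elements of $A$ (any number of summands), where representations differing only in the order of the summands are identified; $p_A(0) = 1$. (Since $\gcd(A)=1$, $p_A(n)\ge 1$ for all sufficiently large $n$.) The constant is $c_0 = \pi\sqrt{2/3}$. The notation $f(n)\sim g(n)$ means $f(n)/g(n)\to 1$. *)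

(* Defs.v *)
From mathcomp Require Import all_boot all_order all_algebra.
From mathcomp Require Import finmap.
From mathcomp Require Import all_classical all_reals all_analysis.

Set Implicit Arguments.
Unset Strict Implicit.
Unset Printing Implicit Defensive.

Import Order.TTheory GRing.Theory Num.Theory.
Import numFieldNormedType.Exports.

Local Open Scope classical_set_scope.
Local Open Scope ring_scope.

(* Cardinals below are taken with [fset_set], which is [fset0] on infinite
   sets; [finite_initial_part] and [finite_partitions] show that this junk value
   is never used for sets of positive integers. *)

Definition initial_part (R : realType) (A : set nat) (x : R) : set nat :=
  [set a | A a /\ a%:R <= x].

Definition counting_function (R : realType) (A : set nat) (x : R) : nat :=
  #|` fset_set (initial_part A x)|.

Definition has_asymptotic_density (R : realType) (A : set nat) (alpha : R) :=
  (counting_function A x)%:R / x @[x --> +oo] --> alpha.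

Definition common_divisor (A : set nat) (d : nat) := forall a, A a -> (d %| a)%N.

Definition is_gcd (A : set nat) (d : nat) :=
  common_divisor A d /\ forall e, common_divisor A e -> (e <= d)%N.

(* A partition is represented by the nonincreasing list of its parts. *)
Definition partitions (A : set nat) (n : nat) : set (seq nat) :=
  [set s | [/\ sorted geq s, (forall a, a \in s -> A a) & sumn s = n]].

Definition partition_function (A : set nat) (n : nat) : nat :=
  #|` fset_set (partitions A n)|.

Definition c0 (R : realType) : R := pi * Num.sqrt (2 / 3).

Definition asymptotically_equivalent (R : realType) (f g : nat -> R) :=
  f n / g n @[n --> \oo] --> (1 : R).

Lemma finite_initial_part (R : realType) (A : set nat) (x : R) :
  finite_set (initial_part A x).
Proof.
apply: (@sub_finite_set _ _ `I_(Num.truncn x).+1); last exact: finite_II.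
move=> a [_ ax] /=; rewrite ltnS truncn_ge_nat //.
exact: le_trans (ler0n _ _) ax.
Qed.

Lemma finite_partitions (A : set nat) (n : nat) :
  A `<=` [set a | (0 < a)%N] -> finite_set (partitions A n).
Proof.
move=> A0.
pose g (k : 'I_n.+1) (t : k.-tuple 'I_n.+1) : seq nat := map val t.
have fin (k : 'I_n.+1) : finite_set (range (@g k)).
  by apply: finite_image; exact: finite_finset.
apply: (@sub_finite_set _ _ (\bigcup_(k in [set: 'I_n.+1]) range (@g k))); last first.
  by apply: bigcup_finite => //; exact: finite_finset.
move=> s [_ sA sn].
have bnd : (size s <= n)%N /\ (forall a, a \in s -> (a <= n)%N).
  rewrite -{n g fin}sn; elim: s sA => [|b s IH] sA //=.
  have [|s1 s2] := IH; first by move=> a sa; apply: sA; rewrite inE sa orbT.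
  have b0 : (0 < b)%N by apply: A0; apply: sA; rewrite inE eqxx.
  split; first by rewrite -add1n leq_add.
  move=> a; rewrite inE => /orP[/eqP ->|/s2 h]; first exact: leq_addr.
  exact: leq_trans h (leq_addl _ _).
case: bnd => szs les.
have szs' : (size s < n.+1)%N by [].
exists (Ordinal szs') => //.
have szt : size (map (@inord n) s) == size s by rewrite size_map.
exists (Tuple szt) => //.
rewrite /g /= -map_comp -[RHS]map_id; apply/eq_in_map => a /les an /=.
by rewrite inordK.
Qed.

(* Main.v *)
Require Import Defs.
From mathcomp Require Import all_boot all_order all_algebra.
From mathcomp Require Import finmap.
From mathcomp Require Import all_classical all_reals all_analysis.
From mathcomp Require Import ring lra zify.

Import Order.TTheory GRing.Theory Num.Theory.
Import numFieldNormedType.Exports.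

Local Open Scope classical_set_scope.
Local Open Scope ring_scope.

(** Write p(n) for the number of partitions of n with parts in A, and
    F(t) = sum_n p(n) e^(-tn) = prod_(a in A) (1 - e^(-ta))^-1 for t > 0. The
    size of p(n) is read off from the growth of F(t) as t tends to 0.

    Growth of F. Expanding the logarithms of the factors gives
    ln F(t) = sum_(k >= 1) G(kt)/k with G(s) = sum_(a in A) e^(-sa). As A has
    density alpha, summation by parts gives s G(s) -> alpha when s -> 0+
    ([expsum_density_bound]); moreover s G(s) <= 1 ([expsum_leV]), so the terms
    k > K contribute at most 1/(Kt) to ln F(t), and t ln F(t) tends to
    C = alpha sum_k 1/k^2 = alpha pi^2/6 ([cvg_ln_partition_gf]). The value of
    sum_k 1/k^2 is [cvg_basel].

    From F to p. The upper bound ln p(n) <= tn + ln F(t) is immediate, and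
    t = sqrt(C/n) turns it into 2 sqrt(Cn) up to lower-order terms. For the lower
    bound, comparing F(t) with F(t(1 + eta)) and F(t(1 - eta)) shows that almost
    all of the sum F(t) comes from the indices m close to C/t^2
    ([chernoff_window]), so that some p(m) with m close to C/t^2 is nearly as
    large as the upper bound allows.

    From m to n. Nothing makes p monotone, but gcd(A) = 1 implies that every
    large integer is a sum of elements of A ([eventually_partitionable]); adjoining
    a fixed partition of n - m to the partitions of m shows p(m) <= p(n) as soon
    as n - m is large ([add_partition_le]). Choosing t so that n lies slightly to
    the right of the indices m that dominate F(t) transfers the lower bound from m
    to n. This Tauberian step is [tauberian_ln_coef], and
    2 sqrt(C) = pi sqrt(2/3) sqrt(alpha). *)

(** * A Tauberian theorem for power series with nonnegative coefficients *)

Lemma nneg_series_le {R : realType} (u : nat -> R) (l : R) n :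
  (forall k, 0 <= u k) -> series u @ \oo --> l -> series u n <= l.
Proof.
move=> u0 ul; rewrite -(cvg_lim _ ul)//.
apply: nondecreasing_cvgn_le; last by apply/cvg_ex; exists l.
by apply: nondecreasing_series => k _ _.
Qed.

(** Exponential tilting: for m <= lo the factor e^(t eta (lo - m)) is at least 1,
    so that replacing t by t(1 + eta) costs at most e^(t eta lo) on the terms
    below the window, and t(1 - eta) plays the same role above it. The terms
    inside the window are estimated one by one. *)
Lemma chernoff_window {R : realType} (p : nat -> R) (F : R -> R)
    (t eta lo hi P : R) (n : nat) :
  (forall m, 0 <= p m) ->
  (forall s, 0 < s -> series (fun m => p m * expR (- (s * m%:R))) @ \oo --> F s) ->
  0 < t -> 0 < eta < 1 -> 0 <= P ->
  (forall m : nat, lo < m%:R < hi -> (m < n)%N /\ p m <= P) ->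
  F t <= expR (t * eta * lo) * F (t * (1 + eta))
       + expR (- (t * eta * hi)) * F (t * (1 - eta))
       + n%:R * (P * expR (- (t * lo))).
Proof.
move=> p0 pF t0 /andP[eta0 eta1] P0 window.
apply: (cvgr_to_le (pF t t0)); apply: nearW => M.
have tp : 0 < t * (1 + eta) by rewrite mulr_gt0//; lra.
have tm : 0 < t * (1 - eta) by rewrite mulr_gt0//; lra.
have pe0 s k : 0 <= p k * expR (- (s * k%:R)) by rewrite mulr_ge0// expR_ge0.
apply: (@le_trans _ _ (\sum_(0 <= k < M)
   (expR (t * eta * lo) * (p k * expR (- (t * (1 + eta) * k%:R))) +
    expR (- (t * eta * hi)) * (p k * expR (- (t * (1 - eta) * k%:R))) +
    (k < n)%:R * (P * expR (- (t * lo)))))).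
  apply: ler_sum => k _.
  have [klo|klo] := leP k%:R lo.
    rewrite -!addrA ler_wpDr//.
      by rewrite addr_ge0// ?mulr_ge0 ?expR_ge0 ?ler0n.
    rewrite mulrCA ler_wpM2l// -expRD ler_expR.
    have : 0 <= t * eta * (lo - k%:R) by rewrite !mulr_ge0 ?(ltW t0) ?(ltW eta0) ?subr_ge0.
    lra.
  have [khi|khi] := leP hi k%:R.
    rewrite [X in _ <= X + _]addrC -!addrA ler_wpDr//.
      by rewrite addr_ge0// ?mulr_ge0 ?expR_ge0 ?ler0n.
    rewrite mulrCA ler_wpM2l// -expRD ler_expR.
    have : 0 <= t * eta * (k%:R - hi) by rewrite !mulr_ge0 ?(ltW t0) ?(ltW eta0) ?subr_ge0.
    lra.
  have [|kn pk] := window k; first by rewrite klo khi.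
  rewrite ler_wpDl//; first by rewrite addr_ge0// ?mulr_ge0 ?expR_ge0.
  rewrite kn mul1r ler_pM ?expR_ge0// ler_expR lerN2.
  by rewrite ler_pM2l// ltW.
rewrite 2!big_split/= -!mulr_sumr -mulr_suml.
apply: lerD; [apply: lerD|].
- by rewrite ler_wpM2l ?expR_ge0//; apply: (nneg_series_le (fun k => p k * expR (- (t * (1 + eta) * k%:R)))) => //; exact: pF.
- by rewrite ler_wpM2l ?expR_ge0//; apply: (nneg_series_le (fun k => p k * expR (- (t * (1 - eta) * k%:R)))) => //; exact: pF.
rewrite ler_wpM2r ?mulr_ge0 ?expR_ge0//.
rewrite -natr_sum ler_nat.
suff -> : (\sum_(0 <= k < M) (k < n) = minn M n)%N by exact: geq_minr.
elim: M => [|M IH]; first by rewrite big_geq// min0n.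
by rewrite big_nat_recr//= IH; lia.
Qed.

(** With t = C/y the sum F(t) is of size e^y up to a factor e^(eps y) and
    concentrates on the m near y^2/C. The index n sits at (1 + 2 delta) y^2/C,
    beyond the window of relative width delta around y^2/C and at a distance from
    it that exceeds N0 for large y, whence p m <= p n throughout the window. A term
    of the window is p m e^(-tm) <= p n e^(-(1 - delta) y), which leaves about
    e^((2 - delta) y) for p n. *)
Lemma window_lower_bound {R : realType} (p : nat -> R) (F : R -> R)
    (C delta : R) (N0 : nat) :
  (forall m, 0 <= p m) ->
  (forall s, 0 < s -> series (fun m => p m * expR (- (s * m%:R))) @ \oo --> F s) ->
  0 < C ->
  (forall e, 0 < e -> \forall s \near 0^'+,
     expR ((C - e) / s) <= F s <= expR ((C + e) / s)) ->
  (forall m n, (m + N0 <= n)%N -> p m <= p n) ->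
  0 < delta <= 2^-1 ->
  \forall y \near +oo, forall n : nat, n%:R = (1 + 2 * delta) * y ^+ 2 / C ->
    expR ((2 - 2 * delta) * y) <= p n.
Proof.
move=> p0 pF C0 FC mono /andP[d0 d1].
(* With the tilt eta = delta/4 chosen below, each tail of F(t) is at most
   e^((1 - 6 eps) y), against e^((1 - eps) y) for F(t) itself. *)
set eps := delta ^+ 2 / 64.
have eps0 : 0 < eps by rewrite divr_gt0// exprn_gt0.
have [T /= T0 FT] : exists2 T : R, 0 < T & forall s, 0 < s < T ->
    expR (C * (1 - eps) / s) <= F s <= expR (C * (1 + eps) / s).
  have := FC _ (mulr_gt0 C0 eps0).
  rewrite near_withinE => -[T /= T0 H]; exists T => // s /andP[s0 sT].
  have := H s; rewrite /= sub0r normrN gtr0_norm// => /(_ sT s0).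
  by rewrite mulrBr mulrDr mulr1.
near=> y => n ny.
have y0 : 0 < y by near: y; exact: (nbhs_pinfty_gt (num_real _)).
set eta := delta / 4; set t := C / y.
have t0 : 0 < t by rewrite divr_gt0.
have eta0 : 0 < eta by rewrite divr_gt0.
have eta1 : eta <= 1 / 8 by rewrite /eta; lra.
have t2 : 2 * t < T.
  rewrite /t mulrA ltr_pdivrMr// -ltr_pdivrMl//; near: y.
  by exact: (nbhs_pinfty_gt (num_real _)).
pose n0 := y ^+ 2 / C.
have tn0 : t * n0 = y by rewrite /t /n0; field; rewrite !gt_eqF.
have nE : n%:R = (1 + 2 * delta) * n0 by rewrite ny /n0 mulrA.
have n00 : 0 < n0 by rewrite divr_gt0// exprn_gt0.
have y1 : 1 <= y by near: y; exact: (nbhs_pinfty_ge (num_real _)).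
have yy : y <= y ^+ 2 by rewrite expr2 ler_peMl// ltW.
have gapN0 : N0%:R <= delta * n0.
  rewrite /n0 mulrA ler_pdivlMr// -ler_pdivrMl//; apply: le_trans yy.
  near: y; exact: (nbhs_pinfty_ge (num_real _)).
have eps_y3 : 3 <= 5 * eps * y.
  have e50 : 0 < 5 * eps by rewrite mulr_gt0.
  rewrite -(ler_pdivrMl _ _ e50).
  near: y; exact: (nbhs_pinfty_ge (num_real _)).
have eps5 : 4 <= expR (5 * eps * y).
  by apply: le_trans (expR_ge1Dx _); lra.
(* The cube of e^(eps y/3) >= eps y/3 beats any multiple of y^2. *)
have epsn : 2 * n%:R <= expR (eps * y).
  have -> : eps * y = 3%:R * (eps * y / 3) by field.
  rewrite expRM_natl; set u := eps * y / 3.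
  have u0 : 0 <= u by rewrite /u !mulr_ge0// ltW.
  apply: (@le_trans _ _ (u ^+ 3)); last first.
    by rewrite lerXn2r ?nnegrE ?expR_ge0//; have := expR_ge1Dx u; lra.
  have yK : 108 / (C * eps ^+ 3) <= y.
    near: y; exact: (nbhs_pinfty_ge (num_real _)).
  have : 108 * n0 <= eps ^+ 3 * y ^+ 3.
    rewrite /n0 mulrA ler_pdivrMr// exprSr [_ ^+ 3]exprS.
    move: yK; rewrite ler_pdivrMr ?mulr_gt0 ?exprn_gt0// => yK.
    have := ler_wpM2r (sqr_ge0 y) yK; lra.
  have -> : u ^+ 3 = eps ^+ 3 * y ^+ 3 / 27 by rewrite /u; field.
  rewrite nE; have := ler_wpM2r (ltW n00) d1; lra.
have window (m : nat) : (1 - delta) * n0 < m%:R < (1 + delta) * n0 ->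
    (m < n)%N /\ p m <= p n.
  move=> /andP[_ mhi].
  have mN : (m + N0 <= n)%N.
    rewrite -(ler_nat R) natrD nE; lra.
  split; last exact: mono.
  by rewrite -(ltr_nat R) nE; nra.
have eta01 : 0 < eta < 1 by lra.
have := chernoff_window p F t eta _ _ _ _ p0 pF t0 eta01 (p0 n) window.
have divt a b : 0 < b -> C * a / (t * b) = y * (a / b).
  by move=> b0; rewrite /t; field; rewrite !gt_eqF.
have /andP[Ft _] : expR (C * (1 - eps) / t) <= F t <= expR (C * (1 + eps) / t).
  by apply: FT; lra.
have tp : 0 < t * (1 + eta) < T.
  by rewrite mulr_gt0 ?(lt_trans _ t2) ?[_ * t]mulrC ?ltr_pM2l//=; lra.
have tm : 0 < t * (1 - eta) < T.
  by rewrite mulr_gt0 ?(lt_trans _ t2) ?[_ * t]mulrC ?ltr_pM2l//=; lra.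
have /andP[_ Fp] := FT _ tp.
have /andP[_ Fm] := FT _ tm.
rewrite divt in Fp; last lra. rewrite divt in Fm; last lra.
rewrite -[t in _ / t]mulr1 divt// divr1 in Ft.
have lowtail : expR (t * eta * ((1 - delta) * n0)) * F (t * (1 + eta)) <=
    expR (y * (1 - 6 * eps)).
  apply: le_trans (ler_wpM2l (expR_ge0 _) Fp) _; rewrite -expRD ler_expR.
  have -> : t * eta * ((1 - delta) * n0) = y * (eta * (1 - delta)).
    by rewrite -tn0; ring.
  rewrite -mulrDr ler_pM2l// addrC -lerBrDr ler_pdivrMr; last lra.
  rewrite /eps /eta; nra.
have hightail : expR (- (t * eta * ((1 + delta) * n0))) * F (t * (1 - eta)) <=
    expR (y * (1 - 6 * eps)).
  apply: le_trans (ler_wpM2l (expR_ge0 _) Fm) _; rewrite -expRD ler_expR.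
  have -> : t * eta * ((1 + delta) * n0) = y * (eta * (1 + delta)).
    by rewrite -tn0; ring.
  rewrite -mulrN -mulrDr ler_pM2l// addrC -lerBrDr ler_pdivrMr; last lra.
  rewrite /eps /eta; nra.
have -> : t * ((1 - delta) * n0) = y * (1 - delta) by rewrite -tn0; ring.
move=> key.
have tails : 4 * expR (y * (1 - 6 * eps)) <= expR (y * (1 - eps)).
  have -> : y * (1 - eps) = 5 * eps * y + y * (1 - 6 * eps) by ring.
  by rewrite expRD ler_wpM2r ?expR_ge0.
have : expR (y * (1 - eps)) <= 2 * n%:R * (p n * expR (- (y * (1 - delta)))).
  lra.
move=> /le_trans /(_ (ler_wpM2r _ epsn)) main.
have : expR (y * (1 - eps)) <= expR (eps * y) * (p n * expR (- (y * (1 - delta)))).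
  by apply: main; rewrite mulr_ge0 ?expR_ge0.
rewrite mulrCA -expRD -ler_pdivrMr ?expR_gt0// -expRB; apply: le_trans.
rewrite ler_expR.
have : 0 <= y * (delta - 2 * eps).
  rewrite mulr_ge0 ?ltW// /eps; nra.
lra.
Unshelve. all: by end_near.
Qed.

Lemma near_le_sqrtn {R : realType} (K : R) :
  \forall n \near \oo, K <= Num.sqrt (n%:R : R).
Proof.
near=> n; apply: (le_trans (ler_norm K)); rewrite -sqrtr_sqr ler_wsqrtr//.
by near: n; exact: nbhs_infty_ger.
Unshelve. all: by end_near. Qed.

(** Monotonicity is only assumed between indices at distance at least N0, which is
    what partitions with gcd 1 satisfy. *)
Lemma tauberian_ln_coef {R : realType} (p : nat -> R) (F : R -> R)
    (C : R) (N0 : nat) :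
  (forall m, 0 <= p m) ->
  (forall s, 0 < s -> series (fun m => p m * expR (- (s * m%:R))) @ \oo --> F s) ->
  0 < C -> s * ln (F s) @[s --> 0^'+] --> C ->
  (forall m n, (m + N0 <= n)%N -> p m <= p n) ->
  ln (p n) / Num.sqrt n%:R @[n --> \oo] --> 2 * Num.sqrt C.
Proof.
move=> p0 pF C0 lnF mono.
have FC e : 0 < e -> \forall s \near 0^'+,
     expR ((C - e) / s) <= F s <= expR ((C + e) / s).
  move=> e0; near=> s.
  have s0 : 0 < s by near: s; exact: nbhs_right_gt.
  have : `|C - s * ln (F s)| < Num.min e C.
    near: s; move/cvgrPdist_lt : lnF; apply.
    by rewrite lt_min e0.
  rewrite lt_min => /andP[+ big]; rewrite ltr_norml => /andP[lo hi].
  have lnF0 : 0 < ln (F s).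
    by rewrite -(pmulr_rgt0 _ s0); move: big; rewrite ltr_norml; lra.
  have Fs0 : 0 < F s by rewrite ltNge; apply/negP => /ln0 F0; rewrite F0 ltxx in lnF0.
  rewrite -(lnK (Fs0 : F s \in Num.pos)) !ler_expR ler_pdivrMr// ler_pdivlMr//; lra.
set c := Num.sqrt C.
have c0 : 0 < c by rewrite sqrtr_gt0.
have cC : c ^+ 2 = C by rewrite sqr_sqrtr// ltW.
have upper e : 0 < e -> \forall n \near \oo,
    p n <= expR ((2 * c + e) * Num.sqrt n%:R).
  move=> e0; have := FC _ (mulr_gt0 e0 c0).
  rewrite near_withinE => -[T /= T0 H]; near=> n.
  have : 2 * c / T <= Num.sqrt n%:R by near: n; exact: near_le_sqrtn.
  have : 1 <= Num.sqrt (n%:R : R) by near: n; exact: near_le_sqrtn.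
  have : n%:R = Num.sqrt (n%:R : R) ^+ 2 by rewrite sqr_sqrtr.
  set r := Num.sqrt _ => rn r1 rT.
  have r0 : 0 < r by lra.
  have s0 : 0 < c / r by rewrite divr_gt0.
  have sT : c / r < T.
    rewrite ltr_pdivrMr// mulrC -ltr_pdivrMr//.
    by apply: lt_le_trans rT; rewrite ltr_pM2r ?invr_gt0//; lra.
  have := H (c / r); rewrite /= sub0r normrN gtr0_norm// => /(_ sT s0) /andP[_ Fs].
  have := nneg_series_le _ _ n.+1 _ (pF _ s0).
  rewrite /series/= big_nat_recr//= => /(_ _)/le_trans/(_ Fs) pn.
  have {}pn : p n * expR (- (c / r * n%:R)) <= expR ((C + e * c) / (c / r)).
    apply: le_trans (pn _); last by move=> k; rewrite mulr_ge0 ?expR_ge0.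
    by rewrite lerDr sumr_ge0// => k _; rewrite mulr_ge0 ?expR_ge0.
  move: pn; rewrite expRN ler_pdivrMr ?expR_gt0// -expRD => /le_trans; apply.
  rewrite ler_expR le_eqVlt; apply/orP; left; apply/eqP.
  by rewrite rn -cC; field; rewrite !gt_eqF.
have lower e : 0 < e -> \forall n \near \oo,
    expR ((2 * c - e) * Num.sqrt n%:R) <= p n.
  (* y = c sqrt(n) / sqrt(1 + 2 d) solves n = (1 + 2 d) y^2 / C, and
     (1 - d) sqrt(1 + 2 d) <= 1 makes y at least (1 - d) c sqrt(n). *)
  move=> e0; pose d := Num.min 2^-1 (e / (4 * c)).
  have d0 : 0 < d by rewrite lt_min invr_gt0 ltr0n divr_gt0 ?mulr_gt0.
  have d1 : d <= 2^-1 by rewrite ge_min lexx.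
  have dc : 4 * c * d <= e.
    by rewrite mulrC -ler_pdivlMr ?mulr_gt0// ge_min lexx orbT.
  have d01 : 0 < d <= 2^-1 by rewrite d0.
  have [Y [_ H]] := window_lower_bound p F C d N0 p0 pF C0 FC mono d01.
  near=> n.
  have : (`|Y| + 1) / ((1 - d) * c) <= Num.sqrt n%:R.
    by near: n; exact: near_le_sqrtn.
  have : 1 <= Num.sqrt (n%:R : R) by near: n; exact: near_le_sqrtn.
  have : n%:R = Num.sqrt (n%:R : R) ^+ 2 by rewrite sqr_sqrtr.
  set r := Num.sqrt _ => rn r1 rY.
  pose q := Num.sqrt (1 + 2 * d).
  have q2 : q ^+ 2 = 1 + 2 * d by rewrite sqr_sqrtr//; lra.
  have q0 : 0 < q by rewrite sqrtr_gt0; lra.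
  have qd : (1 - d) * q <= 1.
    rewrite -(@ler_pXn2r _ 2) ?nnegrE ?mulr_ge0 ?ltW//; last by lra.
    by rewrite exprMn q2; nra.
  have yd : (1 - d) * (c * r) <= c * r / q.
    rewrite ler_pdivlMr// mulrAC ler_piMl// mulr_ge0 ?ltW//; lra.
  apply: le_trans (H (c * r / q) _ n _).
  - rewrite ler_expR.
    have : 0 <= (2 - 2 * d) * (c * r / q - (1 - d) * (c * r)).
      by rewrite mulr_ge0 ?subr_ge0//; lra.
    have : 0 <= (e - 4 * c * d) * r by rewrite mulr_ge0 ?subr_ge0//; lra.
    have : 0 <= d ^+ 2 * c * r by rewrite !mulr_ge0 ?sqr_ge0 ?ltW//; lra.
    nra.
  - apply: lt_le_trans yd; rewrite mulrA -ltr_pdivrMl ?mulr_gt0 ?subr_gt0//; last lra.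
    apply: lt_le_trans rY; rewrite mulrC ltr_pM2r ?invr_gt0 ?mulr_gt0//; last lra.
    by have := ler_norm Y; lra.
  - by rewrite !expr_div_n exprMn q2 cC rn; field; rewrite !gt_eqF//; lra.
apply/cvgrPdist_le => e e0; near=> n.
have lo : expR ((2 * c - e) * Num.sqrt n%:R) <= p n by near: n; exact: lower.
have hi : p n <= expR ((2 * c + e) * Num.sqrt n%:R) by near: n; exact: upper.
have pn0 : 0 < p n by apply: lt_le_trans lo; exact: expR_gt0.
have r0 : 0 < Num.sqrt (n%:R : R).
  by apply: (@lt_le_trans _ _ 1) => //; near: n; exact: near_le_sqrtn.
rewrite distrC ler_distl ler_pdivlMr// ler_pdivrMr//.
apply/andP; split; rewrite -ler_expR lnK//.
Unshelve. all: by end_near.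
Qed.

(** * Partitions with bounded parts and the generating function *)

Lemma partition_function_le (A B : set nat) n :
  B `<=` [set a | (0 < a)%N] -> A `<=` B ->
  (partition_function A n <= partition_function B n)%N.
Proof.
move=> B0 AB; apply: fsubset_leq_card.
have sub : partitions A n `<=` partitions B n.
  by move=> s [? sA ?]; split => // a /sA /AB.
have fB := finite_partitions n B0.
by rewrite -fset_set_sub//; exact: sub_finite_set fB.
Qed.

Lemma mem_le_sumn (s : seq nat) a : a \in s -> (a <= sumn s)%N.
Proof.
elim: s => //= b s IH; rewrite inE => /orP[/eqP ->|/IH]; first exact: leq_addr.
by move=> h; apply: leq_trans h (leq_addl _ _).
Qed.

Lemma partition_function_bounded_parts (A : set nat) N n : (n < N)%N ->
  partition_function (A `&` `I_N) n = partition_function A n.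
Proof.
move=> nN; congr (#|` fset_set _|); apply/seteqP; split => s [? sA sn]; split => //.
  by move=> a /sA [].
move=> a sa; split; first exact: sA.
by rewrite /= (leq_ltn_trans _ nN)// -sn mem_le_sumn.
Qed.

Lemma partition_function_no_parts n : partition_function set0 n = (n == 0)%N.
Proof.
rewrite /partition_function; have [->|n0] := eqVneq n 0%N.
  rewrite (_ : partitions _ _ = [set [::]]) ?fset_set1 ?cardfs1//.
  apply/seteqP; split => [[|a s] [_ sA _]//|_ ->//].
  by have := sA a; rewrite inE eqxx => /(_ isT).
rewrite (_ : partitions _ _ = set0) ?fset_set0//.
apply/seteqP; split => // -[|a s] [_ sA sn]; first by rewrite -sn eqxx in n0.
by have := sA a; rewrite inE eqxx => /(_ isT).
Qed.

(** A partition with parts at most N either has no part N, or starts with the part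
    N, whose removal leaves a partition of n - N with parts at most N. *)
Lemma partition_function_recr (A : set nat) N n : A N -> (0 < N)%N ->
  A `<=` [set a | (0 < a)%N] ->
  partition_function (A `&` `I_N.+1) n =
  (partition_function (A `&` `I_N) n +
   if (N <= n)%N then partition_function (A `&` `I_N.+1) (n - N) else 0)%N.
Proof.
move=> AN N0 A0.
have fin M m : finite_set (partitions (A `&` `I_M) m).
  by apply: finite_partitions => a [/A0].
have sub : partitions (A `&` `I_N) n `<=` partitions (A `&` `I_N.+1) n.
  by move=> s [? sA ?]; split => // a /sA [Aa /= aN]; split => //; exact: leqW.
have [Nn|nN] := leqP N n; last first.
  rewrite addn0 partition_function_bounded_parts ?partition_function_bounded_parts//.
  exact: leqW.
have split_ : partitions (A `&` `I_N.+1) n = partitions (A `&` `I_N) n `|`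
    cons N @` partitions (A `&` `I_N.+1) (n - N).
  apply/seteqP; split=> [s [ss sA sn]|s [/sub//|[s' [ss' sA' sn'] <-]]].
  - case: s => [|a s] in ss sA sn *.
      by left; split.
    have [Aa /= aN] : (A `&` `I_N.+1) a by apply: sA; rewrite inE eqxx.
    have [aN'|aN'] := eqVneq a N; [right|left].
      subst a; exists s => //; split.
      + exact: path_sorted ss.
      + by move=> b sb; apply: sA; rewrite inE sb orbT.
      + by rewrite -sn /= addKn.
    split => // b; rewrite inE => /orP[/eqP ->|sb].
      by split => //=; rewrite ltn_neqAle aN'.
    have [Ab _] : (A `&` `I_N.+1) b by apply: sA; rewrite inE sb orbT.
    split => //=; apply: (@leq_ltn_trans a); last by rewrite ltn_neqAle aN'.
    move: ss => /=; rewrite path_sortedE; last by move=> x y z /= xy yz; exact: leq_trans yz xy.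
    by move=> /andP[/allP/(_ _ sb)].
  - split.
    + rewrite /= path_sortedE; last by move=> x y z /= xy yz; exact: leq_trans yz xy.
      by rewrite ss' andbT; apply/allP => b /sA' [_ /=]; rewrite ltnS.
    + move=> b; rewrite inE => /orP[/eqP ->|/sA'//]; split => //=.
    + by rewrite /= sn' subnKC.
rewrite /partition_function split_ fset_setU ?fset_set_image//; last exact: finite_image.
rewrite cardfsU [X in (_ - X)%N](_ : _ = 0%N) ?subn0.
  by rewrite card_imfset//= => x y [].
apply/eqP; rewrite cardfs_eq0; apply/eqP/fsetP => s; rewrite !inE in_fset_set//.
apply/negP => /andP[]; rewrite inE => -[_ sA _] /imfsetP[/= s' _ sE].
have sN : N \in s by rewrite sE inE eqxx.
by have [_ /=] := sA _ sN; rewrite ltnn.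
Qed.

Lemma partitions_cat (A : set nat) m k s s' :
  partitions A m s -> partitions A k s' -> partitions A (m + k) (sort geq (s ++ s')).
Proof.
move=> [_ sA sm] [_ s'A s'k]; split.
- by apply: sort_sorted => x y; exact: leq_total.
- by move=> a; rewrite mem_sort mem_cat => /orP[/sA|/s'A].
- by rewrite (perm_sumn (permEl (perm_sort _ _))) sumn_cat sm s'k.
Qed.

(** Adjoining a fixed partition of k is injective on the partitions of m: a multiset
    can be cancelled, and a sorted list is determined by its multiset. *)
Lemma add_partition_le (A : set nat) m k :
  A `<=` [set a | (0 < a)%N] -> (partitions A k !=set0) ->
  (partition_function A m <= partition_function A (m + k))%N.
Proof.
move=> A0 [s0 s0P]; rewrite /partition_function.
pose f (s : seq nat) := sort geq (s ++ s0).
have geq_total : total geq by move=> x y; exact: leq_total.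
have geq_trans : transitive geq by move=> x y z /= xy yz; exact: leq_trans yz xy.
have geq_anti : antisymmetric geq by move=> x y /= /andP[xy yx]; apply/eqP; rewrite eqn_leq yx xy.
have finm := finite_partitions m A0.
have fink := finite_partitions (m + k) A0.
have <- : #|` (f @` fset_set (partitions A m))%fset| = #|` fset_set (partitions A m)|.
  apply: card_in_imfset => s s' /=.
  rewrite !in_fset_set// !inE => -[ss _ _] [ss' _ _].
  move=> /(perm_sortP geq_total geq_trans geq_anti) sE.
  by apply: (sorted_eq geq_trans geq_anti ss ss'); rewrite -(perm_cat2r s0).
apply: fsubset_leq_card; rewrite -fset_set_image//.
rewrite -fset_set_sub//; last exact: finite_image.
by move=> _ [s sP <-]; exact: partitions_cat.
Qed.

(** The least positive difference d of two partitionable integers divides every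
    element of A, since the remainder of a modulo d is again such a difference.
    Hence d = 1: some s and s + 1 are both partitionable, and so is
    n = (q - r) s + r (s + 1) for n = q s + r with r < s <= q. *)
Lemma eventually_partitionable (A : set nat) : is_gcd A 1 ->
  exists N0, forall n, (N0 <= n)%N -> partitions A n !=set0.
Proof.
move=> [_ gcd1].
pose rep n := partitions A n !=set0.
have rep0 : rep 0%N by exists [::]; split.
have repD m k : rep m -> rep k -> rep (m + k)%N.
  by move=> [s sm] [s' sk]; eexists; exact: partitions_cat sm sk.
have repM q m : rep m -> rep (q * m)%N.
  by move=> rm; elim: q => // q IH; rewrite mulSn; exact: repD.
have repA a : A a -> rep a.
  move=> Aa; exists [:: a]; split => //=; last by rewrite addn0.
  by move=> b; rewrite inE => /eqP ->.
pose gap d := `[< (0 < d)%N /\ exists2 s, rep s & rep (s + d)%N >].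
have gap_ex : exists d, gap d.
  have [a [Aa a0]] : exists a, A a /\ (0 < a)%N.
    apply: contrapT => noA; suff : (2 <= 1)%N by [].
    apply: gcd1 => a Aa; case: a Aa => // a Aa.
    by exfalso; apply: noA; exists a.+1.
  exists a; apply/asboolP; split => //; exists 0%N => //; exact: repA.
case: (ex_minnP gap_ex) => d /asboolP[d0 [s reps repsd]] dmin.
have dvd_d a : A a -> (d %| a)%N.
  move=> Aa; rewrite /dvdn; apply: contraT; rewrite -lt0n => r0.
  suff : (d <= a %% d)%N by rewrite leqNgt ltn_pmod.
  apply: dmin; apply/asboolP; split => //; exists (a %/ d * (s + d))%N; first exact: repM.
  have -> : (a %/ d * (s + d) + a %% d = a + a %/ d * s)%N.
    by rewrite {3}(divn_eq a d); lia.
  by apply: repD; [exact: repA | exact: repM].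
have d1 : d = 1%N by have := gcd1 _ dvd_d; lia.
subst d; rewrite addn1 in repsd.
exists (s * s)%N => n sn; have [s0|s0] := posnP s.
  by rewrite -(muln1 n); apply: repM; rewrite s0 in repsd.
have -> : n = ((n %/ s - n %% s) * s + n %% s * s.+1)%N.
  have : (n %% s < s)%N by rewrite ltn_pmod.
  have : (s <= n %/ s)%N by rewrite leq_divRL.
  rewrite {3}(divn_eq n s); set q := (n %/ s)%N; set r := (n %% s)%N => sq rs.
  have rq : (r <= q)%N by lia.
  by rewrite -[in LHS](subnK rq) mulnDl mulnS -addnA [(r * s + r)%N]addnC.
by apply: repD; exact: repM.
Qed.


(** * The generating function of partitions *)

(** In terms of formal series the recurrence reads V = U + x^N V. As the v n are
    nonnegative, the partial sums of V are bounded by those of U divided by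
    1 - x^N, so V converges and its limit solves the same equation. *)
Lemma series_divide_1B {R : realType} (u v : nat -> R) (N : nat) (x L : R) :
  (0 < N)%N -> 0 <= x < 1 -> (forall n, 0 <= v n) ->
  (forall n, v n = u n + if (N <= n)%N then v (n - N)%N else 0) ->
  series (fun n => u n * x ^+ n) @ \oo --> L ->
  series (fun n => v n * x ^+ n) @ \oo --> L / (1 - x ^+ N).
Proof.
move=> N0 /andP[x0 x1] v0 vE uL.
have xN1 : x ^+ N < 1 by rewrite exprn_ilt1// -lt0n.
have xN0 : 0 <= x ^+ N by rewrite exprn_ge0.
set U := series (fun n => u n * x ^+ n) in uL *.
set V := series (fun n => v n * x ^+ n).
have recV M : V (M + N)%N = U (M + N)%N + x ^+ N * V M.
  rewrite /V /U /series/=.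
  under eq_bigr => k _ do rewrite vE mulrDl.
  rewrite big_split/=; congr (_ + _).
  rewrite (@big_cat_nat _ _ _ N)//= ?leq_addl// big1_seq ?add0r; last first.
    by move=> k; rewrite mem_index_iota => /andP[_ /andP[_ kN]]; rewrite leqNgt kN mul0r.
  rewrite -{1}[N]add0n big_addn addnK mulr_sumr.
  apply: eq_bigr => k _; rewrite leq_addl addnK exprD; ring.
have mono : nondecreasing_seq V.
  by apply: nondecreasing_series => k _ _; rewrite mulr_ge0 ?exprn_ge0.
have cvgU : cvgn U by apply/cvg_ex; exists L.
have cvgUN : U (M + N)%N @[M --> \oo] --> L by rewrite (cvg_shiftn N U _).
have [B UB] : exists B, forall M, U M <= B.
  have [B [_ UB]] := cvg_seq_bounded cvgU.
  exists (B + 1) => M; apply: (le_trans (ler_norm _)).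
  by apply: UB => //; rewrite ltrDl.
have cvgV : cvgn V.
  apply: nondecreasing_is_cvgn => //; exists (B / (1 - x ^+ N)) => _ [M _ <-].
  rewrite ler_pdivlMr ?subr_gt0// mulrBr mulr1 lerBlDr.
  have := mono _ _ (leq_addr N M); rewrite recV; have := UB (M + N)%N.
  lra.
have -> : L / (1 - x ^+ N) = limn V.
  have VN : V (M + N)%N @[M --> \oo] --> limn V by rewrite (cvg_shiftn N V _).
  have VL : V (M + N)%N @[M --> \oo] --> L + x ^+ N * limn V.
    rewrite (_ : (fun M => V (M + N)%N) = (fun M => U (M + N)%N + x ^+ N * V M)).
      by apply: cvgD => //; apply: cvgMl_tmp.
    by apply/funext => M; rewrite recV.
  have := cvg_unique _ VN VL => /(_ (@norm_hausdorff _ _)) E.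
  have xNn1 : 1 - x ^+ N != 0 by rewrite subr_eq0 gt_eqF.
  by apply: (mulIf xNn1); rewrite divfK// mulrBr mulr1 [limn V * _]mulrC [X in _ = X - _]E addrK.
exact: cvgV.
Qed.

Definition bounded_parts_product {R : realType} (A : set nat) (N : nat) (t : R) : R :=
  \prod_(0 <= a < N | a \in A) (1 - expR (- (t * a%:R)))^-1.

Lemma expRN_natr {R : realType} (t : R) n : expR (- (t * n%:R)) = expR (- t) ^+ n.
Proof. by rewrite -mulNr expRM_natr. Qed.

Lemma expRN_itv {R : realType} (t : R) : 0 < t -> 0 <= expR (- t) < 1.
Proof. by move=> t0; rewrite expR_ge0/= expR_lt1 oppr_lt0. Qed.

Lemma bounded_parts_generating_function {R : realType} (A : set nat) N (t : R) :
  A `<=` [set a | (0 < a)%N] -> 0 < t ->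
  series (fun n => (partition_function (A `&` `I_N) n)%:R * expR (- (t * n%:R)))
    @ \oo --> bounded_parts_product A N t.
Proof.
move=> A0 t0; have x01 := expRN_itv t t0.
under eq_fun do rewrite expRN_natr.
rewrite /bounded_parts_product; elim: N => [|N IH].
  rewrite big_geq//; apply: cvg_near_cst; exists 1%N => // -[//|M] _.
  rewrite /series/= big_ltn// big1_seq => [|k].
    by rewrite II0 setI0 partition_function_no_parts eqxx mul1r expr0 addr0.
  rewrite mem_index_iota => /andP[_ /andP[k0 _]].
  by rewrite II0 setI0 partition_function_no_parts gtn_eqF// mul0r.
rewrite big_mkcond big_nat_recr//= -big_mkcond/=.
case: ifPn => [|]; rewrite (inE, notin_setE) => AN; last first.
  rewrite mulr1 (_ : A `&` `I_N.+1 = A `&` `I_N)//.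
  apply/seteqP; split => a [Aa /= aN]; split => //=; last exact: leqW.
  by rewrite ltn_neqAle -ltnS aN andbT; apply: contra_notN AN => /eqP <-.
have N0 : (0 < N)%N by exact: A0.
rewrite expRN_natr; apply: (series_divide_1B _ _ _ _ _ N0 x01 _ _ IH) => n; first exact: ler0n.
by rewrite [in LHS]partition_function_recr// natrD; case: ifP.
Qed.

(** Partitions of n < N only use parts below N, so the partial sums of the full
    generating function are squeezed between those with bounded parts. The supremum
    of the finite products is then the value of the series; it is described
    here by its two defining inequalities, which dispenses with infinite products. *)
Lemma partition_generating_function {R : realType} (A : set nat) (t B : R) :
  A `<=` [set a | (0 < a)%N] -> 0 < t ->
  (forall N, bounded_parts_product A N t <= B) ->
  exists F : R, [/\
    series (fun n => (partition_function A n)%:R * expR (- (t * n%:R))) @ \oo --> F,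
    F <= B & forall N, bounded_parts_product A N t <= F].
Proof.
move=> A0 t0 PB; set S := series _.
have S_le M : S M <= bounded_parts_product A M t.
  apply: le_trans (nneg_series_le _ _ M _ (bounded_parts_generating_function A M t A0 t0)); last first.
    by move=> k; rewrite mulr_ge0 ?expR_ge0.
  apply: ler_sum_nat => k /andP[_ kM].
  by rewrite partition_function_bounded_parts.
have mono : nondecreasing_seq S.
  by apply: nondecreasing_series => k _ _; rewrite mulr_ge0 ?expR_ge0.
have cvgS : cvgn S.
  by apply: nondecreasing_is_cvgn => //; exists B => _ [M _ <-]; exact: le_trans (S_le M) _.
exists (limn S); split => //.
  by apply: limr_le => //; apply: nearW => M; exact: le_trans (S_le M) _.
move=> N; apply: (cvgr_to_le (bounded_parts_generating_function A N t A0 t0)).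
apply: nearW => M; have SF : S M <= limn S by exact: nondecreasing_cvgn_le.
apply: le_trans SF.
apply: ler_sum => k _; rewrite ler_wpM2r ?expR_ge0// ler_nat.
by apply: partition_function_le => // a [].
Qed.

(** * The logarithm of the generating function *)

Lemma cvgn_sum {R : realType} {J : Type} (r : seq J) (P : pred J)
    (f : J -> nat -> R) (l : J -> R) :
  (forall j, P j -> f j @ \oo --> l j) ->
  \sum_(j <- r | P j) f j n @[n --> \oo] --> \sum_(j <- r | P j) l j.
Proof.
move=> fl; elim: r => [|j r IH].
  by rewrite big_nil; under eq_fun do rewrite big_nil; exact: cvg_cst.
rewrite big_cons; under eq_fun do rewrite big_cons; case: ifPn => // Pj.
by apply: cvgD => //; exact: fl.
Qed.

(** The geometric sum collapses the derivative of the remainder of the logarithmic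
    series to the single term z^K / (1 - z). *)
Lemma is_derive_ln_series_remainder {R : realType} (K : nat) (z : R) : z < 1 ->
  is_derive z 1 (fun y => - ln (1 - y) - \sum_(0 <= k < K) y ^+ k.+1 / k.+1%:R)
    (z ^+ K / (1 - z)).
Proof.
move=> z1; have z10 : 0 < 1 - z by rewrite subr_gt0.
elim: K => [|K IH].
  under eq_fun do rewrite big_geq// subr0.
  have dln := is_derive1_ln z10.
  have d1z : is_derive z 1 (fun y : R => 1 - y) (0 - 1) by apply: is_deriveB.
  have := @is_derive1_comp R (@ln R) (fun y => 1 - y) z _ _ dln d1z.
  move=> /is_deriveN dN.
  rewrite (_ : (fun y => - ln (1 - y)) = - (@ln R \o (fun y => 1 - y)))//.
  apply: (is_derive_eq dN).
  by rewrite expr0 sub0r mulrN1 opprK mul1r.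
have -> : (fun y : R => - ln (1 - y) - \sum_(0 <= k < K.+1) y ^+ k.+1 / k.+1%:R) =
    (fun y : R => - ln (1 - y) - \sum_(0 <= k < K) y ^+ k.+1 / k.+1%:R) -
    (K.+1%:R^-1 : R) *: ((@idfun R) ^+ K.+1).
  apply/funext => y; rewrite big_nat_recr//= opprD addrA; congr (_ - _).
  by rewrite !fctE /GRing.scale/= mulrC.
have dX : is_derive z 1 ((@idfun R) ^+ K.+1) ((K.+1%:R * z ^+ K) *: 1).
  exact: is_deriveX.
apply: (is_derive_eq (is_deriveB IH (is_deriveZ _ dX))).
rewrite -[1 : R^o]/(1:R).
rewrite /GRing.scale/= mulr1 mulKf ?pnatr_eq0//.
by rewrite exprS; field; rewrite gt_eqF.
Qed.

Lemma ln_series_remainder {R : realType} (K : nat) (y : R) : 0 <= y < 1 ->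
  0 <= - ln (1 - y) - \sum_(0 <= k < K) y ^+ k.+1 / k.+1%:R <= y ^+ K / (1 - y).
Proof.
move=> /andP[y0 y1]; pose f (z : R) : R := - ln (1 - z) - \sum_(0 <= k < K) z ^+ k.+1 / k.+1%:R.
rewrite -/(f y).
have [c + ] : exists2 c, c \in `[0, y] & f y - f 0 = c ^+ K / (1 - c) * (y - 0).
  apply: MVT_segment => // [z|].
    by rewrite in_itv/= => /andP[_ zy]; apply: is_derive_ln_series_remainder; lra.
  apply: derivable_within_continuous => z; rewrite in_itv/= => /andP[_ zy].
  have z1 : z < 1 by lra.
  by have [] := is_derive_ln_series_remainder K z z1.
rewrite in_itv/= => /andP[c0 cy]; rewrite subr0.
have -> : f 0 = 0.
  rewrite /f subr0 ln1 oppr0 sub0r big1 ?oppr0// => k _.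
  by rewrite expr0n mul0r.
rewrite subr0 => ->.
have c1 : 0 < 1 - c by lra.
apply/andP; split; first by rewrite mulr_ge0// divr_ge0 ?exprn_ge0// ltW.
apply: (@le_trans _ _ (y ^+ K / (1 - y) * y)).
  rewrite ler_wpM2r//; apply: ler_pM; rewrite ?exprn_ge0// ?invr_ge0 ?(ltW c1)//.
    by rewrite lerXn2r.
  by rewrite lef_pV2 ?posrE; lra.
by rewrite ler_piMr ?(ltW y1)// divr_ge0 ?exprn_ge0//; lra.
Qed.

Lemma cvg_ln_series {R : realType} (y : R) : 0 <= y < 1 ->
  \sum_(0 <= k < K) y ^+ k.+1 / k.+1%:R @[K --> \oo] --> - ln (1 - y).
Proof.
move=> y01; have /andP[y0 y1] := y01.
have yK : y ^+ K / (1 - y) @[K --> \oo] --> (0 : R).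
  rewrite -[X in _ --> X](mul0r (1 - y)^-1); apply: cvgMr_tmp.
  by apply: cvg_expr; rewrite ger0_norm.
have lo : (- ln (1 - y) - y ^+ K / (1 - y)) @[K --> \oo] --> - ln (1 - y).
  by rewrite -[X in _ --> X]subr0; apply: cvgB => //; exact: cvg_cst.
apply: (squeeze_cvgr _ lo); last exact: (cvg_cst (- ln (1 - y))).
apply: nearW => K; have := ln_series_remainder K y y01.
lra.
Qed.


(** * Abelian estimates for a set of positive density *)

(** Summation by parts against the decreasing weights x^k, in the stronger form
    x^n (u 0 + ... + u (n - 1)) <= sum_(k < n) u k x^k, which passes through
    the induction. *)
Lemma abel_sum_ge0 {R : realType} (u : nat -> R) (x : R) n :
  0 <= x <= 1 -> (forall m, 0 <= \sum_(0 <= k < m) u k) ->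
  0 <= \sum_(0 <= k < n) u k * x ^+ k.
Proof.
move=> /andP[x0 x1] U0.
suff : x ^+ n * (\sum_(0 <= k < n) u k) <= \sum_(0 <= k < n) u k * x ^+ k.
  by apply: le_trans; rewrite mulr_ge0 ?exprn_ge0.
elim: n => [|n IH]; first by rewrite !big_geq// mulr0.
rewrite [leRHS]big_nat_recr//=.
apply: (@le_trans _ _ (x ^+ n * \sum_(0 <= k < n.+1) u k)).
  by rewrite ler_wpM2r// exprS ler_piMl// exprn_ge0.
by rewrite big_nat_recr//= mulrDr [u n * _]mulrC lerD2r.
Qed.

Definition expsum {R : realType} (A : set nat) (N : nat) (s : R) : R :=
  \sum_(0 <= a < N | a \in A) expR (- (s * a%:R)).

Lemma expsum_ge0 {R : realType} (A : set nat) N (s : R) : 0 <= expsum A N s.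
Proof. by rewrite sumr_ge0// => a _; exact: expR_ge0. Qed.

(** Positive integers contribute at most x/(1 - x) = 1/(e^s - 1) with x = e^(-s). *)
Lemma expsum_leV {R : realType} (A : set nat) N (s : R) :
  A `<=` [set a | (0 < a)%N] -> 0 < s -> expsum A N s <= s^-1.
Proof.
move=> A0 s0; set x := expR (- s).
have x0 : 0 <= x by exact: expR_ge0.
have x1 : x < 1 by rewrite expR_lt1 oppr_lt0.
have sx : s * x <= 1 - x.
  have : x * (1 + s) <= x * expR s by rewrite ler_wpM2l// expR_ge1Dx.
  rewrite -expRD addNr expR0; lra.
case: N => [|N]; first by rewrite /expsum big_geq// invr_ge0 ltW.
apply: (@le_trans _ _ (\sum_(1 <= a < N.+1) x ^+ a)).
  rewrite /expsum big_mkcond big_ltn//= -[leRHS]add0r; apply: lerD.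
    by case: ifPn => //; rewrite inE => /A0.
  apply: ler_sum => a _; case: ifP => _; last by rewrite exprn_ge0.
  by rewrite expRN_natr.
have geo : (1 - x) * (\sum_(1 <= a < N.+1) x ^+ a) <= x.
  elim: N => [|N IH]; first by rewrite big_geq// mulr0.
  suff : (1 - x) * (\sum_(1 <= a < N.+2) x ^+ a) = x - x ^+ N.+2.
    by move=> ->; rewrite gerBl exprn_ge0.
  elim: {IH}N => [|N IH]; first by rewrite big_nat1; ring.
  by rewrite big_nat_recr//= mulrDr IH !exprS; ring.
rewrite -[s^-1]mul1r ler_pdivlMr//.
set E := \sum_(_ <= _ < _) _ in geo *.
have E0 : 0 <= E by rewrite sumr_ge0// => a _; rewrite exprn_ge0.
nra.
Qed.

Lemma nondecreasing_expsum {R : realType} (A : set nat) (s : R) :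
  nondecreasing_seq (fun N => expsum A N s).
Proof.
apply/nondecreasing_seqP => N; rewrite /expsum big_mkcond [leRHS]big_mkcond.
by rewrite big_nat_recr//= lerDl; case: ifP => // _; exact: expR_ge0.
Qed.

Lemma cvgn_expsum {R : realType} (A : set nat) (s : R) :
  A `<=` [set a | (0 < a)%N] -> 0 < s -> cvgn (fun N => expsum A N s).
Proof.
move=> A0 s0; apply: nondecreasing_is_cvgn; first exact: nondecreasing_expsum.
by exists s^-1 => _ [N _ <-]; exact: expsum_leV.
Qed.

Lemma counting_functionE (R : realType) (A : set nat) n :
  counting_function A (n%:R : R) = (\sum_(0 <= k < n.+1) (k \in A))%N.
Proof.
have fin := finite_initial_part A (n%:R : R).
rewrite /counting_function.
have -> : fset_set (initial_part A (n%:R : R)) = [fset k in [seq k <- index_iota 0 n.+1 | k \in A]]%fset.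
  apply/fsetP => k; rewrite in_fset_set// !inE mem_filter mem_index_iota/= ltnS.
  apply/idP/idP => [|/andP[]]; rewrite inE.
    by move=> -[Ak]; rewrite ler_nat => ->; rewrite andbT inE.
  by move=> Ak kn; rewrite inE; split; rewrite ?ler_nat.
rewrite card_fseq undup_id ?filter_uniq ?iota_uniq// size_filter.
by rewrite -sum1_count big_mkcond; apply: eq_bigr => k _; case: (k \in A).
Qed.

Lemma density_partial_sums {R : realType} (A : set nat) (alpha e : R) :
  has_asymptotic_density A alpha -> 0 < e ->
  exists2 D : R, 0 <= D & forall n,
    `|\sum_(0 <= k < n) ((k \in A)%:R - alpha)| <= D + e * n%:R.
Proof.
move=> dens e0.
have := (cvg_pinftyP _ _).1 dens (fun n => n%:R).
have ninf : (n%:R : R) @[n --> \oo] --> +oo by exact/cvgryPge/nbhs_infty_ger.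
move=> /(_ ninf)/cvgrPdist_le/(_ _ e0) [N _ HN].
pose S n : R := \sum_(0 <= k < n) ((k \in A)%:R - alpha).
have step n : `|S n.+1| <= `|S n| + (1 + `|alpha|).
  rewrite /S big_nat_recr//= (le_trans (ler_normD _ _))// lerD2l.
  rewrite (le_trans (ler_normB _ _))// lerD2r.
  by case: (n \in A); rewrite ?normr1 ?normr0.
have small n : `|S n| <= n%:R * (1 + `|alpha|).
  elim: n => [|n IH]; first by rewrite /S big_geq// normr0 mul0r.
  apply: (le_trans (step n)); rewrite -natr1 mulrDl mul1r; lra.
have big n : (N < n)%N -> `|S n.+1| <= e * n%:R + `|alpha|.
  move=> Nn; have n0 : 0 < n%:R :> R by rewrite ltr0n; lia.
  have := HN n (ltnW Nn).
  rewrite /= counting_functionE natr_sum => H.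
  have -> : S n.+1 = (\sum_(0 <= i < n.+1) (i \in A)%:R - alpha * n%:R) - alpha.
    rewrite /S sumrB sumr_const_nat subn0 mulrSr -[alpha *+ n]mulr_natr; ring.
  rewrite (le_trans (ler_normB _ _))// lerD2r.
  have -> : \sum_(0 <= i < n.+1) (i \in A)%:R - alpha * n%:R =
     - (alpha - (\sum_(0 <= i < n.+1) (i \in A)%:R) / n%:R) * n%:R.
    by field; rewrite gt_eqF.
  by rewrite normrM normrN (gtr0_norm n0) ler_pM2r.
exists (N.+2%:R * (1 + `|alpha|) + `|alpha|) => [|n].
  by rewrite addr_ge0// mulr_ge0// addr_ge0.
rewrite -/(S n); have [nN|Nn] := leqP n N.+1.
  apply: (le_trans (small n)); rewrite -addrA ler_wpDr//.
    by rewrite addr_ge0// mulr_ge0// ltW.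
  by rewrite ler_wpM2r ?addr_ge0// ler_nat ltnW.
case: n Nn => // n Nn; apply: (le_trans (big n Nn)).
have : 0 <= N.+2%:R * (1 + `|alpha|) by rewrite mulr_ge0// addr_ge0.
by rewrite -natr1; lra.
Qed.

(** The Abelian half: s G(s) -> alpha, with an error that is explicit in s because it
    is used at the points s = t, 2t, ..., Kt simultaneously. The partial sums of
    1_A - alpha are at most D + e n in absolute value, i.e. at most the partial
    sums of the sequence e + D [k = 0]; by [abel_sum_ge0] this comparison
    survives the weights x^k, x = e^(-s), and 1/(1 - x) lies between 1/s and
    1/s + 1. *)
Lemma expsum_density_bound {R : realType} (A : set nat) (alpha e : R) :
  A `<=` [set a | (0 < a)%N] -> 0 < alpha -> has_asymptotic_density A alpha -> 0 < e ->
  exists2 D : R, 0 <= D & forall s, 0 < s ->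
    `|s * limn (fun N => expsum A N s) - alpha| <= e + D * s.
Proof.
move=> A0 alpha0 dens e0.
have [D D0 HD] := density_partial_sums A alpha e dens e0.
exists (D + e + alpha); first by rewrite !addr_ge0// ltW.
move=> s s0; set x := expR (- s); set G := limn _.
have x0 : 0 <= x by exact: expR_ge0.
have x1 : x < 1 by rewrite expR_lt1 oppr_lt0.
pose E N := \sum_(0 <= k < N) x ^+ k.
have EL : E @ \oo --> (1 - x)^-1.
  have := @cvg_geometric_series R 1 x; rewrite ger0_norm// => /(_ x1).
  rewrite mul1r (_ : series (geometric 1 x) = E)//.
  by apply/funext => N; apply: eq_bigr => k _; rewrite /= mul1r.
have GL : expsum A N s @[N --> \oo] --> G by exact: cvgn_expsum.
(* The signs b = 1 and b = -1 give the two sides of the estimate. *)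
have side (b : R) : `|b| <= 1 -> forall N,
   0 <= D + e * E N + b * (expsum A N s - alpha * E N).
  move=> b1 N.
  pose u k := D * (k == 0)%:R + e + b * ((k \in A)%:R - alpha).
  have u0 m : 0 <= \sum_(0 <= k < m) u k.
    case: m => [|m]; first by rewrite big_geq.
    rewrite big_split/= -mulr_sumr big_split/= -mulr_sumr.
    rewrite sumr_const_nat subn0 -[e *+ _]mulr_natr.
    have -> : \sum_(0 <= k < m.+1) (k == 0)%:R = 1 :> R.
      rewrite big_ltn//= big1_seq ?addr0// => -[|k]; by rewrite mem_index_iota.
    rewrite mulr1.
    set S := \sum_(0 <= k < m.+1) _.
    have : `|b * S| <= D + e * m.+1%:R.
      rewrite normrM; apply: le_trans (HD m.+1); rewrite ler_piMl//.
    rewrite ler_norml; lra.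
  have := abel_sum_ge0 u x N _ u0; rewrite x0 (ltW x1) => /(_ isT).
  move=> /le_trans; apply.
  have -> : expsum A N s = \sum_(0 <= k < N) (k \in A)%:R * x ^+ k.
    rewrite /expsum big_mkcond; apply: eq_bigr => k _.
    by rewrite expRN_natr; case: ifP; rewrite ?mul1r ?mul0r.
  have -> : \sum_(0 <= k < N) u k * x ^+ k = D * (\sum_(0 <= k < N) (k == 0)%:R * x ^+ k)
      + e * E N + b * (\sum_(0 <= k < N) (k \in A)%:R * x ^+ k - alpha * E N).
    rewrite /E !mulr_sumr -sumrB mulr_sumr -!big_split/=.
    by apply: eq_bigr => k _; rewrite /u; ring.
  rewrite !lerD2r ler_piMr//; case: N => [|N]; first by rewrite big_geq.
  rewrite big_ltn//= big1_seq ?addr0 ?mulr1 ?expr0//.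
  by move=> [|k]; rewrite mem_index_iota//= mul0r.
have lim_side b : `|b| <= 1 -> 0 <= D + e * (1 - x)^-1 + b * (G - alpha * (1 - x)^-1).
  move=> /side side_b.
  have lim_b : D + e * E N + b * (expsum A N s - alpha * E N) @[N --> \oo] -->
      D + e * (1 - x)^-1 + b * (G - alpha * (1 - x)^-1).
    apply: cvgD; first by apply: cvgD; [exact: cvg_cst | exact: cvgMl_tmp].
    by apply: cvgMl_tmp; apply: cvgB => //; exact: cvgMl_tmp.
  by apply: (cvgr_to_ge lim_b); exact: nearW.
have p1 := lim_side 1; rewrite normr1 in p1; have {}p1 := p1 (lexx _).
have m1 := lim_side (-1); rewrite normrN1 in m1; have {}m1 := m1 (lexx _).
have sx : s * x <= 1 - x.
  have : x * (1 + s) <= x * expR s by rewrite ler_wpM2l// expR_ge1Dx.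
  rewrite -expRD addNr expR0; lra.
have sx1 : 1 - x <= s by have := expR_ge1Dx (- s); rewrite -/x; lra.
have w1 : 1 <= s * (1 - x)^-1 by rewrite ler_pdivlMr ?subr_gt0// mul1r.
have w2 : s * (1 - x)^-1 <= 1 + s by rewrite ler_pdivrMr ?subr_gt0//; nra.
set w := (1 - x)^-1 in p1 m1 w1 w2.
rewrite ler_norml; apply/andP; split; nra.
Qed.

(** * The Basel sum *)

Lemma sin_le_id {R : realType} (x : R) : 0 <= x -> sin x <= x.
Proof.
move=> x0.
have [c _] : exists2 c, c \in `[0, x] & sin x - sin 0 = cos c * (x - 0).
  apply: MVT_segment => //; apply: continuous_subspaceT; exact: continuous_sin.
rewrite sin0 !subr0 => ->; rewrite ler_piMl// cos_le1.
Qed.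

Lemma id_le_tan {R : realType} (x : R) : 0 <= x < pi / 2 -> x <= tan x.
Proof.
move=> /andP[x0 xpi].
have cos_gt0 y : y \in `[0, x] -> 0 < cos y.
  rewrite in_itv/= => /andP[y0 yx]; apply: cos_gt0_pihalf.
  by rewrite (le_lt_trans yx)// andbT (lt_le_trans _ y0)// oppr_lt0 divr_gt0 ?pi_gt0.
have [c cx] : exists2 c, c \in `[0, x] & tan x - tan 0 = (cos c) ^- 2 * (x - 0).
  apply: MVT_segment => // [y|].
    move=> yx; apply: is_derive_tan; rewrite gt_eqF// cos_gt0//.
    exact: subset_itv_oo_cc yx.
  apply: continuous_in_subspaceT => y; rewrite inE/= => yx.
  by apply: continuous_tan; rewrite gt_eqF// cos_gt0.
rewrite tan0 !subr0 => ->; rewrite ler_peMl// invf_ge1 ?exprn_gt0 ?cos_gt0//.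
Qed.

(** sin x <= x <= tan x, inverted and squared, as cot^2 = 1/sin^2 - 1. *)
Lemma invr_sqr_sin_bounds {R : realType} (x : R) : 0 < x < pi / 2 ->
  (sin x) ^- 2 - 1 <= x ^- 2 <= (sin x) ^- 2.
Proof.
move=> xpi; have /andP[x0 x1] := xpi.
have s0 : 0 < sin x by apply: sin_gt0_pihalf.
have c0 : 0 < cos x.
  by apply: cos_gt0_pihalf; rewrite x1 andbT (lt_trans _ x0)// oppr_lt0 divr_gt0 ?pi_gt0.
have tx : x <= sin x / cos x by apply: id_le_tan; rewrite ltW.
apply/andP; split; last first.
  rewrite lef_pV2 ?posrE ?exprn_gt0// lerXn2r ?nnegrE ?(ltW s0) ?(ltW x0)//.
  exact/sin_le_id/ltW.
have -> : (sin x) ^- 2 - 1 = (sin x / cos x) ^- 2.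
  rewrite expr_div_n invf_div cos2sin2; field; exact: lt0r_neq0.
rewrite lef_pV2 ?posrE ?exprn_gt0 ?divr_gt0//.
by rewrite lerXn2r ?nnegrE ?(ltW x0)// ltW ?divr_gt0.
Qed.

Lemma sum_fold_half {V : nmodType} (f : nat -> V) (N : nat) : (0 < N)%N ->
  \sum_(1 <= k < N.*2) f k = f N + \sum_(1 <= k < N) (f k + f (N.*2 - k)%N).
Proof.
move=> N0; rewrite (@big_cat_nat _ _ _ N)//=; last by lia.
rewrite [X in _ + X]big_ltn; last by lia.
rewrite big_split/= addrCA; congr (_ + (_ + _)).
rewrite big_nat_rev/= -addn1 addnC big_addn.
have -> : (N.*2 - N = N)%N by lia.
by apply: eq_big_nat => k kN; congr f; lia.
Qed.

(** The angles are the multiples of pi/2^(n+1) strictly between 0 and pi/2, where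
    1/sin^2 x and 1/x^2 differ by at most 1. *)
Definition csc2_sum {R : realType} (n : nat) : R :=
  \sum_(1 <= k < 2 ^ n) (sin (k%:R * pi / (2 ^ n.+1)%:R)) ^- 2.

(** Pairing the angles x and pi/2 - x, 1/sin^2 x + 1/cos^2 x = 4/sin^2(2x)
    reduces level n+1 to level n; the unpaired angle pi/4 contributes 2. *)
Lemma csc2_sumE {R : realType} n : csc2_sum n = 2 * (4 ^+ n - 1) / 3 :> R.
Proof.
elim: n => [|n IH]; first by rewrite /csc2_sum big_geq// expr0 subrr mulr0 mul0r.
have N0 : (0 < 2 ^ n)%N by rewrite expn_gt0.
have p2 : (2 ^ n)%:R != 0 :> R by rewrite pnatr_eq0 -lt0n.
rewrite /csc2_sum [(2 ^ n.+1)%N in X in \sum_(1 <= k < X) _]expnS mul2n sum_fold_half//.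
have -> : (2 ^ n)%:R * pi / (2 ^ n.+2)%:R = pi / 4 :> R.
  rewrite !expnS !natrM; field; exact: p2.
have -> : (sin (pi / 4 : R)) ^- 2 = 2.
  have := cos2Dsin2 (pi / 4 : R).
  have := cosBpihalf (pi / 4 : R).
  have -> : pi / 4 - pi / 2 = - (pi / 4) :> R by field.
  rewrite cosN => -> sc.
  have -> : sin (pi / 4) ^+ 2 = 1 / 2 :> R by lra.
  by rewrite invf_div divr1.
have := IH; rewrite /csc2_sum.
rewrite (_ : \sum_(1 <= k < 2 ^ n) (_ + _) =
    \sum_(1 <= k < 2 ^ n) 4 * (sin (k%:R * pi / (2 ^ n.+1)%:R)) ^- 2 :> R).
  by rewrite -mulr_sumr exprS => ->; field.
apply: eq_big_nat => k /andP[k1 kN].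
set x : R := k%:R * pi / (2 ^ n.+2)%:R.
have x0 : 0 < x by rewrite !(divr_gt0, mulr_gt0) ?pi_gt0 ?ltr0n// expn_gt0.
have xpi : x < pi / 2.
  rewrite /x !expnS !natrM ltr_pdivrMr ?mulr_gt0 ?ltr0n//.
  have : k%:R * pi < (2 ^ n)%:R * pi :> R by rewrite ltr_pM2r ?pi_gt0 ?ltr_nat.
  have : 0 < (2 ^ n)%:R * pi :> R by rewrite mulr_gt0 ?pi_gt0 ?ltr0n.
  lra.
have -> : (((2 ^ n).*2 - k)%N)%:R * pi / (2 ^ n.+2)%:R = pi / 2 - x :> R.
  rewrite natrB; last by lia.
  rewrite /x -mul2n !expnS !natrM; field; exact: p2.
have -> : k%:R * pi / (2 ^ n.+1)%:R = x *+ 2 :> R.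
  rewrite /x !expnS !natrM -mulr_natl; field; exact: p2.
have s0 : 0 < sin x by apply: sin_gt0_pihalf; rewrite x0.
have c0 : 0 < cos x.
  by apply: cos_gt0_pihalf; rewrite xpi andbT (lt_trans _ x0)// oppr_lt0 divr_gt0 ?pi_gt0.
have -> : sin (pi / 2 - x) = cos x by rewrite sinB sin_pihalf cos_pihalf; ring.
rewrite sin_mulr2n; have := cos2Dsin2 x.
set c := cos x in c0 *; set s := sin x in s0 * => cs.
have -> : s ^- 2 + c ^- 2 = (c ^+ 2 + s ^+ 2) / (c * s) ^+ 2.
  by field; rewrite !gt_eqF.
by rewrite cs -mulr_natl; field; rewrite !gt_eqF.
Qed.

(** 1/x^2 = 4^(n+1) / (pi k)^2 at the angle x = k pi/2^(n+1), so [csc2_sumE] and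
    [invr_sqr_sin_bounds] give the partial sum over k < 2^n up to O(2^-n). *)
Lemma cvg_basel {R : realType} :
  series (fun k => (k.+1%:R ^- 2 : R)) @ \oo --> (pi ^+ 2 / 6 : R).
Proof.
pose H (N : nat) : R := \sum_(1 <= k < N) k%:R ^- 2.
have pi0 := @pi_gt0 R.
have four n : 4 ^+ n = (2 ^ n)%:R ^+ 2 :> R.
  by rewrite -!natrX -expnM mulnC expnM.
have alg (w a b : R) : 0 < w -> 0 < a -> 0 < b ->
    (a * w / (2 * b)) ^- 2 = 4 * b ^+ 2 / w ^+ 2 * a ^- 2.
  by move=> w0 a0 b0; field; rewrite !gt_eqF.
have HE n : series (fun k => (k.+1%:R ^- 2 : R)) n = H n.+1.
  by rewrite /series/= /H big_add1.
have Hpow n : csc2_sum n - (2 ^ n)%:R <= 4 * 4 ^+ n / pi ^+ 2 * H (2 ^ n)%N <= csc2_sum n.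
  rewrite /csc2_sum /H mulr_sumr; set N := (2 ^ n)%N.
  have bnd k : (1 <= k < N)%N ->
      (sin (k%:R * pi / (2 ^ n.+1)%:R : R)) ^- 2 - 1 <= 4 * 4 ^+ n / pi ^+ 2 * k%:R ^- 2
      <= (sin (k%:R * pi / (2 ^ n.+1)%:R : R)) ^- 2.
    move=> /andP[k1 kN].
    have k0 : 0 < k%:R :> R by rewrite ltr0n.
    have N0 : 0 < N%:R :> R by rewrite ltr0n expn_gt0.
    have := invr_sqr_sin_bounds (k%:R * pi / (2 ^ n.+1)%:R : R).
    have -> : (k%:R * pi / (2 ^ n.+1)%:R) ^- 2 = 4 * 4 ^+ n / pi ^+ 2 * k%:R ^- 2 :> R.
      rewrite expnS natrM four -/N.
      exact: alg.
    apply; rewrite expnS natrM -/N divr_gt0 ?mulr_gt0//=.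
    rewrite ltr_pdivrMr ?mulr_gt0//.
    have : k%:R * pi < N%:R * pi :> R by rewrite ltr_pM2r// ltr_nat.
    lra.
  apply/andP; split; last first.
    by apply: ler_sum_nat => k /bnd /andP[].
  apply: (@le_trans _ _ (\sum_(1 <= k < N)
      ((sin (k%:R * pi / (2 ^ n.+1)%:R : R)) ^- 2 - 1))); last first.
    by apply: ler_sum_nat => k /bnd /andP[].
  rewrite sumrB lerB// sumr_const_nat ler_nat; lia.
have Hmono : {homo H : m n / (m <= n)%N >-> m <= n}.
  move=> [|m] [|n] mn //.
    by rewrite {1}/H big_geq// sumr_ge0// => k _; rewrite invr_ge0 exprn_ge0.
  rewrite -!HE.
  by apply: nondecreasing_series => // k _ _; rewrite invr_ge0 exprn_ge0.
have two n : 1 <= (2 ^ n)%:R :> R by rewrite ler1n expn_gt0.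
have Hup n : H n <= pi ^+ 2 / 6.
  apply: (@le_trans _ _ (H (2 ^ n)%N)); first by apply: Hmono; exact/ltnW/ltn_expl.
  have /andP[_] := Hpow n; rewrite csc2_sumE four mulrAC ler_pdivrMr ?exprn_gt0//.
  have N1 := two n; set N := _%:R in N1 *; set p2 := pi ^+ 2.
  have p20 : 0 < p2 by rewrite exprn_gt0.
  have N0 : 0 < 4 * N ^+ 2 by rewrite mulr_gt0// exprn_gt0//; lra.
  move=> h; rewrite -(ler_pM2l N0).
  apply: le_trans h _; lra.
have Hlo n : pi ^+ 2 / 6 - pi ^+ 2 / (2 ^ n)%:R <= H (2 ^ n)%N.
  have /andP[+ _] := Hpow n; rewrite csc2_sumE four [4 * _ / _ * _]mulrAC ler_pdivlMr ?exprn_gt0//.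
  have N1 := two n; set N := _%:R in N1 *; set p2 := pi ^+ 2.
  have p20 : 0 < p2 by rewrite exprn_gt0.
  have N0 : 0 < 4 * N ^+ 2 by rewrite mulr_gt0// exprn_gt0//; lra.
  move=> h; rewrite -(ler_pM2l N0).
  apply: le_trans h.
  have -> : 4 * N ^+ 2 * (p2 / 6 - p2 / N) = (2 / 3 * N ^+ 2 - 4 * N) * p2.
    by field; rewrite gt_eqF//; lra.
  rewrite ler_pM2r//; lra.
apply/cvgrPdist_le => e e0.
have [N Ne] : exists N : nat, pi ^+ 2 / e <= N%:R.
  by exists (Num.truncn (pi ^+ 2 / e)).+1; rewrite ltW// truncnS_gt.
exists (2 ^ N)%N => // n /= Nn; rewrite HE.
rewrite ler_distlC; apply/andP; split; last first.
  by apply: (le_trans (Hup _)); rewrite lerDl ltW.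
apply: (le_trans _ (Hmono _ _ (leqW Nn))); apply: (le_trans _ (Hlo N)).
rewrite lerD2l lerN2 ler_pdivrMr; last by have := two N; lra.
rewrite mulrC -ler_pdivrMr//; apply: (le_trans Ne).
by rewrite ler_nat ltnW// ltn_expl.
Qed.


(** * Growth of the logarithm of the generating function *)

Lemma bounded_parts_productE {R : realType} (A : set nat) N (t : R) :
  A `<=` [set a | (0 < a)%N] -> 0 < t ->
  bounded_parts_product A N t =
  expR (\sum_(0 <= a < N | a \in A) - ln (1 - expR (- (t * a%:R)))).
Proof.
move=> A0 t0; rewrite expR_sum; apply: eq_bigr => a; rewrite inE => /A0/= a0.
rewrite [expR (- ln _)]expRN lnK// posrE subr_gt0 expR_lt1 oppr_lt0 mulr_gt0//.
by rewrite ltr0n.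
Qed.

(** Each logarithm is expanded in powers, and the finite sum over a is exchanged
    with the series over k. *)
Lemma cvg_expsum_series {R : realType} (A : set nat) N (t : R) :
  A `<=` [set a | (0 < a)%N] -> 0 < t ->
  series (fun k => expsum A N (k.+1%:R * t) / k.+1%:R) @ \oo -->
  \sum_(0 <= a < N | a \in A) - ln (1 - expR (- (t * a%:R))).
Proof.
move=> A0 t0.
rewrite (_ : series _ = fun K => \sum_(0 <= a < N | a \in A)
    \sum_(0 <= k < K) expR (- (t * a%:R)) ^+ k.+1 / k.+1%:R).
  apply: cvgn_sum => a; rewrite inE => /A0/= a0; apply: cvg_ln_series.
  by rewrite expR_ge0 expR_lt1 oppr_lt0 mulr_gt0// ltr0n.
apply/funext => K; rewrite exchange_big/=; apply: eq_bigr => k _.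
rewrite /expsum mulr_suml; apply: eq_bigr => a _; congr (_ / _).
by rewrite -expRM_natl; congr expR; ring.
Qed.

Lemma sum_invr_sqr_le {R : realType} (K K' : nat) : (0 < K <= K')%N ->
  \sum_(K <= k < K') k.+1%:R ^- 2 <= (K%:R^-1 : R).
Proof.
move=> /andP[K0 KK'].
apply: (@le_trans _ _ (- K'%:R^-1 - - K%:R^-1)); last first.
  by rewrite opprK gerDr oppr_le0 invr_ge0.
rewrite -(telescope_sumr (fun k : nat => - k%:R^-1 : R) KK').
apply: ler_sum_nat => k /andP[Kk _].
have k0 : 0 < k%:R :> R by rewrite ltr0n; lia.
rewrite -natr1.
have -> : - (k%:R + 1)^-1 - - k%:R^-1 = (k%:R * (k%:R + 1))^-1 :> R.
  by field; rewrite !gt_eqF//; lra.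
rewrite lef_pV2 ?posrE ?exprn_gt0 ?mulr_gt0//; nra.
Qed.

Definition expsum_lim {R : realType} (A : set nat) (s : R) : R :=
  limn (fun N => expsum A N s).

Definition log_gf_approx {R : realType} (A : set nat) (K : nat) (t : R) : R :=
  \sum_(0 <= k < K) expsum_lim A (k.+1%:R * t) / k.+1%:R.

Lemma cvg_expsum_lim {R : realType} (A : set nat) (s : R) :
  A `<=` [set a | (0 < a)%N] -> 0 < s ->
  expsum A N s @[N --> \oo] --> expsum_lim A s.
Proof. exact: cvgn_expsum. Qed.

(** As s G(s) <= 1, the terms k > K of the series are at most 1/(k^2 t), with sum at
    most 1/(K t). *)
Lemma log_product_le {R : realType} (A : set nat) N K (t : R) :
  A `<=` [set a | (0 < a)%N] -> 0 < t -> (0 < K)%N ->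
  \sum_(0 <= a < N | a \in A) - ln (1 - expR (- (t * a%:R))) <=
  log_gf_approx A K t + K%:R^-1 / t.
Proof.
move=> A0 t0 K0; apply: (cvgr_to_le (cvg_expsum_series A N t A0 t0)).
exists K => // K' /= KK'.
have kt0 k : 0 < k.+1%:R * t by rewrite mulr_gt0.
rewrite /series/= (@big_cat_nat _ _ _ K)//=; apply: lerD.
  apply: ler_sum => k _; rewrite ler_wpM2r ?invr_ge0//.
  apply: nondecreasing_cvgn_le; first exact: nondecreasing_expsum.
  exact: cvgn_expsum.
apply: (@le_trans _ _ (\sum_(K <= k < K') k.+1%:R ^- 2 / t)).
  apply: ler_sum => k _; rewrite ler_pdivrMr//; apply: (le_trans (expsum_leV _ _ _ A0 (kt0 k))).
  rewrite le_eqVlt; apply/orP; left; apply/eqP; field; rewrite !gt_eqF//=.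
by rewrite -mulr_suml ler_wpM2r ?invr_ge0 ?(ltW t0)// sum_invr_sqr_le// K0.
Qed.

Lemma log_gf_approx_le {R : realType} (A : set nat) K (t B : R) :
  A `<=` [set a | (0 < a)%N] -> 0 < t ->
  (forall N, \sum_(0 <= a < N | a \in A) - ln (1 - expR (- (t * a%:R))) <= B) ->
  log_gf_approx A K t <= B.
Proof.
move=> A0 t0 HB.
have cvgK : \sum_(0 <= k < K) expsum A N (k.+1%:R * t) / k.+1%:R @[N --> \oo] -->
    log_gf_approx A K t.
  apply: cvgn_sum => k _; apply: cvgMr_tmp; apply: cvg_expsum_lim => //.
  by rewrite mulr_gt0.
apply: (cvgr_to_le cvgK); apply: nearW => N; apply: le_trans (HB N).
apply: (nneg_series_le (fun k => expsum A N (k.+1%:R * t) / k.+1%:R)) => [k|].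
  by rewrite divr_ge0 ?expsum_ge0.
exact: cvg_expsum_series.
Qed.

Definition partition_gf {R : realType} (A : set nat) (t : R) : R :=
  limn (series (fun n => (partition_function A n)%:R * expR (- (t * n%:R)))).

Lemma partition_gf_bounds {R : realType} (A : set nat) (t : R) :
  A `<=` [set a | (0 < a)%N] -> 0 < t ->
  series (fun n => (partition_function A n)%:R * expR (- (t * n%:R))) @ \oo
    --> partition_gf A t /\
  forall K, (0 < K)%N ->
    log_gf_approx A K t <= ln (partition_gf A t) <= log_gf_approx A K t + K%:R^-1 / t.
Proof.
move=> A0 t0.
have PB K : (0 < K)%N -> forall N, bounded_parts_product A N t <=
    expR (log_gf_approx A K t + K%:R^-1 / t).
  by move=> K0 N; rewrite bounded_parts_productE// ler_expR log_product_le.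
have FE K : (0 < K)%N ->
    [/\ series (fun n => (partition_function A n)%:R * expR (- (t * n%:R))) @ \oo
          --> partition_gf A t,
        partition_gf A t <= expR (log_gf_approx A K t + K%:R^-1 / t) &
        forall N, bounded_parts_product A N t <= partition_gf A t].
  move=> K0; have [F [SF FB PF]] := partition_generating_function A t _ A0 t0 (PB K K0).
  by rewrite /partition_gf (cvg_lim _ SF).
split; first by have [] := FE 1%N isT.
move=> K /FE[_ FB PF].
have F0 : 0 < partition_gf A t.
  by apply: lt_le_trans (PF 0%N); rewrite bounded_parts_productE// expR_gt0.
apply/andP; split; last by rewrite -ler_expR lnK.
apply: log_gf_approx_le => // N.
by rewrite -ler_expR lnK// -bounded_parts_productE.
Qed.

(** t times the k-th term of the expansion of ln F(t) is (kt) G(kt) / k^2, which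
    tends to alpha/k^2; the truncation error is 1/K uniformly in t, so the limits
    in t and K may be exchanged. *)
Lemma cvg_ln_partition_gf {R : realType} (A : set nat) (alpha : R) :
  A `<=` [set a | (0 < a)%N] -> 0 < alpha -> has_asymptotic_density A alpha ->
  t * ln (partition_gf A t) @[t --> 0^'+] --> alpha * (pi ^+ 2 / 6).
Proof.
move=> A0 alpha0 dens; apply/cvgrPdist_le => eps eps0.
pose zeta K : R := \sum_(0 <= k < K) k.+1%:R ^- 2.
have zetaL : alpha * zeta K @[K --> \oo] --> alpha * (pi ^+ 2 / 6).
  by apply: cvgMl_tmp; exact: cvg_basel.
have eps4 : 0 < eps / 4 by rewrite divr_gt0.
have [K1 _ HK1] := (cvgrPdist_le _ _).1 zetaL _ eps4.
have [K [K0 zetaK invK]] : exists K, [/\ (0 < K)%N,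
    `|alpha * (pi ^+ 2 / 6) - alpha * zeta K| <= eps / 4 & K%:R^-1 <= eps / 4].
  pose m := (Num.truncn (4 / eps)).+1.
  exists (maxn K1 m); split; first by rewrite leq_max orbT.
    by apply: HK1; rewrite /= leq_maxl.
  rewrite -[eps / 4]invrK lef_pV2 ?posrE ?invr_gt0// ?ltr0n ?leq_max ?orbT// invf_div.
  apply: (@le_trans _ _ m%:R); last by rewrite ler_nat leq_maxr.
  by rewrite ltW// truncnS_gt.
have K0' : 0 < K%:R :> R by rewrite ltr0n.
have e0 : 0 < eps / (4 * K%:R) by rewrite divr_gt0// mulr_gt0.
have [D D0 HD] := expsum_density_bound A alpha _ A0 alpha0 dens e0.
have D1 : 0 < D + 1 by lra.
have T0 := divr_gt0 e0 D1.
near=> t.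
have t0 : 0 < t by near: t; exact: nbhs_right_gt.
have tD : D * t <= eps / (4 * K%:R).
  have : t < eps / (4 * K%:R) / (D + 1) by near: t; exact: nbhs_right_lt.
  rewrite ltr_pdivlMr//; lra.
have [_ /(_ K K0)/andP[lo hi]] := partition_gf_bounds A t A0 t0.
have approx : `|t * log_gf_approx A K t - alpha * zeta K| <= eps / 2.
  rewrite /log_gf_approx /zeta !mulr_sumr -sumrB.
  apply: (le_trans (ler_norm_sum _ _ _)).
  apply: (@le_trans _ _ (\sum_(0 <= k < K) eps / (2 * K%:R))); last first.
    rewrite sumr_const_nat subn0 -mulr_natr le_eqVlt; apply/orP; left; apply/eqP.
    by field; rewrite gt_eqF.
  apply: ler_sum => k _.
  have k0 : 0 < k.+1%:R :> R by rewrite ltr0n.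
  have k1 : 1 <= k.+1%:R :> R by rewrite ler1n.
  have kt0 : 0 < k.+1%:R * t by rewrite mulr_gt0.
  set g := expsum_lim A _.
  have -> : t * (g / k.+1%:R) - alpha * k.+1%:R ^- 2 =
      (k.+1%:R * t * g - alpha) / k.+1%:R ^+ 2 by field; rewrite gt_eqF.
  rewrite normrM [X in _ * X]gtr0_norm ?invr_gt0 ?exprn_gt0//.
  rewrite ler_pdivrMr ?exprn_gt0//; apply: (le_trans (HD _ kt0)).
  have -> : eps / (2 * K%:R) = 2 * (eps / (4 * K%:R)) by field; rewrite gt_eqF.
  set u := eps / (4 * K%:R) in e0 tD *.
  have u0 := ltW e0.
  have : k.+1%:R * (D * t) <= k.+1%:R * u by rewrite ler_pM2l.
  have : 0 <= (k.+1%:R - 1) * (k.+1%:R * u).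
    by apply: mulr_ge0; [rewrite subr_ge0 | apply: mulr_ge0].
  have : 0 <= (k.+1%:R - 1) * u by apply: mulr_ge0; rewrite ?subr_ge0.
  have : 0 <= k.+1%:R * u by rewrite mulr_ge0.
  lra.
have tlo : t * log_gf_approx A K t <= t * ln (partition_gf A t) by rewrite ler_pM2l.
have thi : t * ln (partition_gf A t) <= t * log_gf_approx A K t + K%:R^-1.
  have -> : t * log_gf_approx A K t + K%:R^-1 = t * (log_gf_approx A K t + K%:R^-1 / t).
    by field; rewrite !gt_eqF.
  by rewrite ler_pM2l.
move: approx zetaK; rewrite !ler_norml => /andP[? ?] /andP[? ?].
apply/andP; split; lra.
Unshelve. all: by end_near.
Qed.

Theorem theorem4 (R : realType) (A : set nat) (alpha : R)
    (hpos : A `<=` [set a | (0 < a)%N])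
    (hgcd : is_gcd A 1)
    (halpha : 0 < alpha)
    (hdens : has_asymptotic_density A alpha) :
  asymptotically_equivalent
    (fun n : nat => ln (partition_function A n)%:R)
    (fun n : nat => c0 R * Num.sqrt (alpha * n%:R)).
Proof.
have [N0 HN0] := eventually_partitionable A hgcd.
have pi0 := @pi_gt0 R.
set C : R := alpha * (pi ^+ 2 / 6).
have C0 : 0 < C by rewrite mulr_gt0// divr_gt0// exprn_gt0.
have mono m n : (m + N0 <= n)%N ->
    (partition_function A m)%:R <= (partition_function A n)%:R :> R.
  move=> mn; rewrite ler_nat -(@subnKC m n); last by lia.
  by apply: add_partition_le => //; apply: HN0; lia.
have := tauberian_ln_coef (fun n => (partition_function A n)%:R) (partition_gf A) C N0
  (fun=> ler0n _ _) (fun s s0 => (partition_gf_bounds A s hpos s0).1) C0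
  (cvg_ln_partition_gf A alpha hpos halpha hdens) mono.
have cE : c0 R * Num.sqrt alpha = 2 * Num.sqrt C.
  rewrite /c0 -mulrA -sqrtrM; last by rewrite divr_ge0.
  have -> : C = (pi / 2) ^+ 2 * (2 / 3 * alpha) by rewrite /C; field.
  rewrite [in RHS]sqrtrM ?sqr_ge0// sqrtr_sqr gtr0_norm ?divr_gt0//.
  by move: (pi : R) => q; field.
have c0_gt0 : 0 < c0 R * Num.sqrt alpha by rewrite cE mulr_gt0// sqrtr_gt0.
rewrite -cE => lim; rewrite /asymptotically_equivalent.
rewrite -[X in _ --> X](divff (lt0r_neq0 c0_gt0)).
under eq_fun do rewrite sqrtrM ?ltW// mulrA invfM mulrCA mulrC.
exact: cvgMr_tmp.
Qed.
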